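(* Let an increasing price function $P:\mathbb{N}_{\ge 1}\to\mathbb{R}_{\ge 0}$, such that basic zone tariffs with respect to $P$ satisfy the no-stopover property (i.e. $P(k)\le P(i)+P(k-i+1)$ for all $k\ge 1$, $1\le i\le k$), and a price $P_M\in\mathbb{R}_{\ge 0}$ be given. Then all zone tariffs with metropolitan zone with respect to $P$ and $P_M$ satisfy the no-elongation property if and only if $P_M\le P(2)$.
   Context: ''Increasing'' means non-decreasing. A PTN is a finite, simple, connected, undirected graph $(V,E)$. A path is a finite sequence $(x_1,\dots,x_n)$, $n\ge 1$, of (not necessarily distinct) nodes with consecutive nodes adjacent; $\mathcal{W}$ is the set of all paths; $[x_i,x_j]$ denotes the subpath $(x_i,\dots,x_j)$. A zone partition $\mathcal{Z}$ is a partition of $V$ into nonempty sets called zones. The zone border weight of an edge $e=\{x,y\}$ is $b(e)=0$ if $x,y$ lie in the same zone and $b(e)=1$ otherwise; $z(W)=1+\sum_{i=1}^{n-1}b(x_i,x_{i+1})$ for a path $W=(x_1,\dots,x_n)$. The basic zone tariff with respect to $P$ is $W\mapsto P(z(W))$. A metropolitan zone is a union $Z_M=\bigcup_{Z\in\mathcal{Z}_M}Z$ for some $\mathcal{Z}_M\subseteq\mathcal{Z}$; it is assumed to contain at least one node and to be connected (its induced subgraph is connected). A path is included in $Z_M$ if all its nodes lie in $Z_M$. The zone tariff with metropolitan zone $Z_M$, price function $P$ and metropolitan price $P_M$ is the fare structure with $p(W)=P_M$ if $W$ is included in $Z_M$ and $p(W)=P(z(W))$ otherwise. No-stopover property of a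 fare structure $p$: $p([x_1,x_n])\le p([x_1,x_i])+p([x_i,x_n])$ for all paths $(x_1,\dots,x_n)\in\mathcal{W}$, $n\ge 3$, $2\le i\le n-1$. No-elongation property: $p([x_1,x_{n-1}])\le p([x_1,x_n])$ for all paths $(x_1,\dots,x_n)\in\mathcal{W}$, $n\ge 2$. *)

(* Defs.v *)
From mathcomp Require Import all_boot all_order all_algebra.
From mathcomp Require Import reals.

Set Implicit Arguments.
Unset Strict Implicit.
Unset Printing Implicit Defensive.

Import Order.TTheory GRing.Theory Num.Theory.
Local Open Scope ring_scope.

Record ptn := Ptn {
  ptn_node :> finType;
  adj : rel ptn_node;
  adj_sym : symmetric adj;
  adj_irr : irreflexive adj;
  adj_connected : forall x y, connect adj x y
}.

(* Nodes may be repeated. *)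
Definition is_path (G : ptn) (W : seq G) : bool :=
  (W != [::]) && sorted (@adj G) W.

(* [x_i, x_j], with the nodes of W = (x_1, ..., x_n) numbered from 1. *)
Definition subpath (G : ptn) (W : seq G) (i j : nat) : seq G :=
  drop i.-1 (take j W).

Definition zone_partition (G : ptn) (Z : {set {set G}}) : bool :=
  partition Z [set: G].

Definition border_weight (G : ptn) (Z : {set {set G}}) (x y : G) : nat :=
  if y \in pblock Z x then 0%N else 1%N.

(* zip W (behead W) lists the pairs (x_i, x_{i+1}) for 1 <= i <= n - 1. *)
Definition zone_count (G : ptn) (Z : {set {set G}}) (W : seq G) : nat :=
  (1 + \sum_(e <- zip W (behead W)) border_weight Z e.1 e.2)%N.

(* Only the values on sequences satisfying is_path are meaningful. *)
Definition fare_structure (R : realType) (G : ptn) := seq G -> R.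

Definition basic_zone_tariff (R : realType) (P : nat -> R) (G : ptn)
    (Z : {set {set G}}) : fare_structure R G :=
  fun W => P (zone_count Z W).

Definition induced_connected (G : ptn) (M : {set G}) : Prop :=
  {in M &, forall x y,
    connect [rel u v | [&& u \in M, v \in M & adj u v]] x y}.

Definition metropolitan_zone (G : ptn) (Z : {set {set G}}) (M : {set G}) :
    Prop :=
  [/\ exists2 ZM : {set {set G}}, ZM \subset Z & M = \bigcup_(A in ZM) A,
      M != set0
    & induced_connected M].

Definition included_in (G : ptn) (W : seq G) (M : {set G}) : bool :=
  all (fun x => x \in M) W.

Definition metropolitan_zone_tariff (R : realType) (P : nat -> R) (PM : R)
    (G : ptn) (Z : {set {set G}}) (M : {set G}) : fare_structure R G :=
  fun W => if included_in W M then PM else P (zone_count Z W).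

Definition no_stopover (R : realType) (G : ptn) (p : fare_structure R G) :
    Prop :=
  forall W : seq G, is_path W -> (3 <= size W)%N ->
  forall i : nat, (2 <= i <= (size W).-1)%N ->
    p (subpath W 1 (size W)) <= p (subpath W 1 i) + p (subpath W i (size W)).

Definition no_elongation (R : realType) (G : ptn) (p : fare_structure R G) :
    Prop :=
  forall W : seq G, is_path W -> (2 <= size W)%N ->
    p (subpath W 1 (size W).-1) <= p (subpath W 1 (size W)).

(* A function N_{>=1} -> R_{>=0} is represented by a function on nat whose
   value at 0 is unconstrained; it is never used, as zone_count is positive. *)
Definition price_function (R : realType) (P : nat -> R) : Prop :=
  forall k : nat, (1 <= k)%N -> 0 <= P k.

Definition increasing_price (R : realType) (P : nat -> R) : Prop :=
  forall k l : nat, (1 <= k)%N -> (k <= l)%N -> P k <= P l.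

(* Main.v *)
(* MathComp *)
Require Import Defs.
From mathcomp Require Import all_boot all_order all_algebra.
From mathcomp Require Import reals.

(** Deleting the last node [y] of a path can change its fare regime only when
    the remaining path lies in the metropolitan zone [M] and [y] does not.
    Otherwise both fares are [PM], or both are values of [P] at zone counts
    that increase along the path ([zone_count_rcons]).

    In the critical case the last edge leaves [M]. As [M] is a union of zones,
    this edge crosses a zone border ([border_weight_exit]), so the longer path
    counts at least two zones and costs at least [P 2], whereas the shorter one
    costs [PM]. Hence [PM <= P 2] suffices. It is also necessary: on a single
    edge whose two endpoints are separate zones, one of them being [M], the
    critical case occurs with a zone count of exactly two. *)

Set Implicit Arguments.
Unset Strict Implicit.
Unset Printing Implicit Defensive.

Import Order.TTheory GRing.Theory Num.Theory.
Local Open Scope ring_scope.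

Lemma zone_count_rcons (G : ptn) (Z : {set {set G}}) (s : seq G) (x y : G) :
  zone_count Z (rcons (rcons s x) y) =
  (zone_count Z (rcons s x) + border_weight Z x y)%N.
Proof.
rewrite /zone_count -addnA; congr (1 + _)%N.
elim: s => [|a s IHs] /=; first by rewrite big_seq1 big_nil.
by case: s IHs => [|b s] /= IHs; rewrite big_cons IHs [in RHS]big_cons addnA.
Qed.

(** The zone of [x] is a member of [ZM], being the only block of [Z] that
    contains [x]; it is therefore contained in [M] and misses [y]. *)
Lemma border_weight_exit (G : ptn) (Z : {set {set G}}) (M : {set G}) (x y : G) :
  zone_partition Z -> metropolitan_zone Z M ->
  x \in M -> y \notin M -> border_weight Z x y = 1%N.
Proof.
move=> /and3P[_ trivZ _] [[ZM sZM ->] _ _] /bigcupP[A ZM_A Ax] M'y.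
rewrite /border_weight (def_pblock trivZ (subsetP sZM A ZM_A) Ax).
by case: ifP => // Ay; case/bigcupP: M'y; exists A.
Qed.

Lemma no_elongation_rcons (R : realType) (G : ptn) (p : fare_structure R G) :
  (forall s x y, is_path (rcons (rcons s x) y) ->
     p (rcons s x) <= p (rcons (rcons s x) y)) <->
  no_elongation p.
Proof.
have all_but_last (s : seq G) y :
    subpath (rcons s y) 1 (size (rcons s y)).-1 = s.
  by rewrite /subpath drop0 size_rcons -cats1 take_size_cat.
have whole (W : seq G) : subpath W 1 (size W) = W.
  by rewrite /subpath drop0 take_size.
split=> [p_le W | p_le s x y W_path].
  case/lastP: W => // W y; case/lastP: W => // s x W_path _.
  by rewrite all_but_last whole p_le.
by have := p_le _ W_path; rewrite all_but_last whole !size_rcons => ->.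
Qed.

Lemma metropolitan_no_elongation (R : realType) (P : nat -> R) (PM : R)
    (G : ptn) (Z : {set {set G}}) (M : {set G}) :
  increasing_price P -> PM <= P 2%N ->
  zone_partition Z -> metropolitan_zone Z M ->
  no_elongation (metropolitan_zone_tariff P PM Z M).
Proof.
move=> P_incr le_PM_P2 partZ metroM; apply/no_elongation_rcons => s x y _.
rewrite /metropolitan_zone_tariff /included_in [in all _ (rcons _ y)]all_rcons.
have [sxM | _] := boolP (all _ (rcons s x)); last first.
  by rewrite andbF zone_count_rcons P_incr ?leq_addr.
rewrite andbT; case: ifPn => // M'y.
have Mx : x \in M by move: sxM; rewrite all_rcons => /andP[].
apply: le_trans le_PM_P2 (P_incr _ _ _ _) => //.
by rewrite zone_count_rcons (border_weight_exit partZ metroM Mx M'y) addn1.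
Qed.

Definition bool_adj : rel bool := fun x y => x != y.

Lemma bool_adj_sym : symmetric bool_adj.
Proof. by move=> x y; rewrite /bool_adj eq_sym. Qed.

Lemma bool_adj_irr : irreflexive bool_adj.
Proof. by move=> x; rewrite /bool_adj eqxx. Qed.

Lemma bool_adj_connected (x y : bool) : connect bool_adj x y.
Proof. by have [-> // | ne_xy] := eqVneq x y; apply: connect1. Qed.

Definition edge_ptn : ptn := Ptn bool_adj_sym bool_adj_irr bool_adj_connected.

Definition edge_zones : {set {set edge_ptn}} := [set [set true]; [set false]].

Lemma edge_zones_partition : zone_partition edge_zones.
Proof.
apply/and3P; split.
- rewrite /cover bigcup_setU !big_set1.
  by apply/eqP/setP => -[]; rewrite !inE.
- apply/trivIsetP => A B; rewrite !inE.
  by case/orP=> /eqP-> /orP[]/eqP-> //; rewrite ?eqxx // disjoints1 inE.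
- by rewrite !inE; apply/norP; split; apply/eqP=> /setP e;
    [have := e true | have := e false]; rewrite !inE.
Qed.

Lemma edge_metropolitan_zone : metropolitan_zone edge_zones [set true].
Proof.
split.
- by exists [set [set true]]; rewrite ?big_set1 // sub1set !inE eqxx.
- by apply/set0Pn; exists true; rewrite inE.
- by move=> x y; rewrite !inE => /eqP-> /eqP->; apply: connect0.
Qed.

Theorem theorem27 (R : realType) (P : nat -> R) (PM : R)
    (P_price : price_function P)
    (P_incr : increasing_price P)
    (P_stopover : forall (G : ptn) (Z : {set {set G}}),
        zone_partition Z -> no_stopover (basic_zone_tariff P Z))
    (PM_ge0 : 0 <= PM) :
  (forall (G : ptn) (Z : {set {set G}}) (M : {set G}),
      zone_partition Z -> metropolitan_zone Z M ->
      no_elongation (metropolitan_zone_tariff P PM Z M))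
  <-> PM <= P 2%N.
Proof.
split=> [no_elong | le_PM_P2 G Z M]; last exact: metropolitan_no_elongation.
have partZ := edge_zones_partition; have metroM := edge_metropolitan_zone.
have /no_elongation_rcons p_le := no_elong _ _ _ partZ metroM.
have := p_le [::] true false isT.
rewrite /metropolitan_zone_tariff /included_in (zone_count_rcons _ [::]) /=.
rewrite !inE /= (border_weight_exit partZ metroM) ?inE //.
by rewrite /zone_count big_nil.
Qed.
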